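(* Let $H$ be an abelian group of order $m$ and $K$ a group of order $n$ with $\gcd(m,n)=1$, and let $G=H\times K$. Let $\tilde\star$ be any multiplicative Lie algebra structure on $G$ (with $H$ carrying the trivial structure, i.e. $a\,\tilde\star\,b=1$ for all $a,b\in H$). Then there exist a multiplicative Lie algebra structure $\star$ on $K$ and a map $\Gamma:K\to \mathrm{End}(H)$, $x\mapsto\Gamma_x$, such that for all $x,y,z\in K$ and $h,k,l\in H$: 1. $\Gamma_{xy}(h)=\Gamma_x(h)\Gamma_y(h)$ and $\Gamma_{x\star y}(h)=\Gamma_x(\Gamma_y(h))\,\Gamma_y(\Gamma_x(h^{-1}))$; 2. $\Gamma_{x\star y}(l)\,\Gamma_{y\star z}(h)\,\Gamma_{z\star x}(k)=1$; and $\tilde\star$ is given by $$(h,x)\,\tilde\star\,(k,y)=\big(\Gamma_x(k)\,\Gamma_y(h^{-1}),\;x\star y\big)\quad\text{for all }(h,x),(k,y)\in G.$$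
   Context: All groups are written multiplicatively and ${}^{a}b = aba^{-1}$. A multiplicative Lie algebra structure on a group $G$ is a binary operation $\star$ on $G$ such that for all $x,y,z\in G$: (i) $x\star x=1$; (ii) $x\star(yz)=(x\star y)\,{}^{y}(x\star z)$; (iii) $(xy)\star z={}^{x}(y\star z)\,(x\star z)$; (iv) $((x\star y)\star{}^{y}z)\,((y\star z)\star{}^{z}x)\,((z\star x)\star{}^{x}y)=1$; (v) ${}^{z}(x\star y)={}^{z}x\star{}^{z}y$. It is trivial if $x\star y=1$ for all $x,y$. $\mathrm{End}(H)$ is the set of group endomorphisms of $H$. $H$ is identified with the subgroup $H\times\{1\}$ of $G=H\times K$. *)

(* Defs.v *)
From mathcomp Require Import all_boot all_fingroup.

Set Implicit Arguments.
Unset Strict Implicit.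
Unset Printing Implicit Defensive.

Local Open Scope group_scope.

(* Conjugation [x ^ y] of the library is y^-1 * x * y, so the left conjugate
   a * b * a^-1 of b by a is written [b ^ a^-1]. *)
Record isMulLie (G : groupType) (star : G -> G -> G) : Prop := MulLie {
  mulLie_alt : forall x, star x x = 1;
  mulLie_mulr : forall x y z,
    star x (y * z) = star x y * (star x z) ^ y^-1;
  mulLie_mull : forall x y z,
    star (x * y) z = (star y z) ^ x^-1 * star x z;
  mulLie_jacobi : forall x y z,
    star (star x y) (z ^ y^-1) * star (star y z) (x ^ z^-1)
      * star (star z x) (y ^ x^-1) = 1;
  mulLie_conj : forall x y z,
    (star x y) ^ z^-1 = star (x ^ z^-1) (y ^ z^-1) }.

(* Main.v *)
Require Import Defs.
From mathcomp Require Import all_boot all_fingroup.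
From mathcomp Require Import cyclic.

(** A multiplicative Lie product is a homomorphism in each variable up to
    conjugation.  In [G = H * K], conjugating by an element of one factor does
    not change the component in the other factor.  Hence, for fixed [u], the
    [H]-component of [u ** (1, y)] is a homomorphism in [y : K] and the
    [K]-component of [u ** (k, 1)] a homomorphism in [k : H], where [**] stands
    for the product given on [G].  As the orders of [H] and [K] are coprime,
    such homomorphisms are trivial ([morph_coprime_eq1]); the same holds in the
    first variable ([mulLie_cross_r], [mulLie_cross_l]).

    Together with the triviality of the product on [H], this leaves only
    [(h, x) ** (k, y) = (1, star x y)], where [star x y] is the [K]-component of
    [(1, x) ** (1, y)] ([mulLie_coprime_prod]).  The structure on [K] is this
    component, its axioms being the [K]-components of those on [G].

    So [Gamma] is forced to be trivial: it is a homomorphism from [K] to the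
    additive group of endomorphisms of [H], whose exponent divides the order
    of [H].  The identities required of [Gamma] then read [1 = 1]. *)

Local Open Scope group_scope.

Lemma morph_coprime_eq1 {A B : finGroupType} {f : A -> B} :
    coprime #|[set: A]| #|[set: B]| -> {morph f : x y / x * y} ->
  forall x, f x = 1.
Proof.
move=> coAB fM x; apply/eqP; rewrite -order_eq1 -dvdn1.
have f1 : f 1 = 1 by apply: (mulgI (f 1)); rewrite -fM !mulg1.
have fX n : f (x ^+ n) = f x ^+ n.
  by elim: n => [|n IHn]; rewrite ?expg0 ?f1 // !expgS fM IHn.
have oA : #[f x] %| #|[set: A]|.
  by rewrite order_dvdn -fX expg_cardG ?inE // f1.
by rewrite -(eqP coAB) dvdn_gcd oA order_dvdG ?inE.
Qed.

(** The maps [i] and [p] are meant to be the inclusion of one factor of a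
    direct product and the projection to the other factor: conjugation by the
    image of [i] is invisible through [p], so the twist in the distributive
    law disappears. *)
Lemma mulLie_cross_r {G : groupType} {star : G -> G -> G} (lieG : isMulLie star)
    {A B : finGroupType} {i : A -> G} {p : G -> B} :
    coprime #|[set: A]| #|[set: B]| ->
    {morph i : x y / x * y} -> {morph p : x y / x * y} ->
    (forall g a, p (g ^ (i a)^-1) = p g) ->
  forall u a, p (star u (i a)) = 1.
Proof.
move=> coAB iM pM pJ u; apply: (morph_coprime_eq1 coAB) => a b.
by rewrite iM (mulLie_mulr lieG) pM pJ.
Qed.

Lemma mulLie_cross_l {G : groupType} {star : G -> G -> G} (lieG : isMulLie star)
    {A B : finGroupType} {i : A -> G} {p : G -> B} :
    coprime #|[set: A]| #|[set: B]| ->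
    {morph i : x y / x * y} -> {morph p : x y / x * y} ->
    (forall g a, p (g ^ (i a)^-1) = p g) ->
  forall a u, p (star (i a) u) = 1.
Proof.
move=> coAB iM pM pJ a u; apply: invg_inj; rewrite invg1.
(* Left distributivity reverses the factors, hence the inverse. *)
apply: (morph_coprime_eq1 (f := fun b => (p (star (i b) u))^-1) coAB) => b c.
by rewrite iM (mulLie_mull lieG) pM pJ invgM.
Qed.

Section CoprimeProduct.

Variables (H K : finGroupType) (starG : H * K -> H * K -> H * K).
Hypothesis coHK : coprime #|[set: H]| #|[set: K]|.
Hypothesis lieG : isMulLie starG.

Let inH (h : H) : H * K := (h, 1).
Let inK (x : K) : H * K := (1, x).

Let inHM : {morph inH : h k / h * k}.
Proof. by move=> h k; congr pair; rewrite mulg1. Qed.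

Let inKM : {morph inK : x y / x * y}.
Proof. by move=> x y; congr pair; rewrite mulg1. Qed.

Let fstM : {morph (fun u : H * K => u.1) : u v / u * v}.
Proof. by []. Qed.

Let sndM : {morph (fun u : H * K => u.2) : u v / u * v}.
Proof. by []. Qed.

Let fst_conjK (u : H * K) x : (u ^ (inK x)^-1).1 = u.1.
Proof. by rewrite -[RHS]conjg1 -invg1. Qed.

Let snd_conjH (u : H * K) h : (u ^ (inH h)^-1).2 = u.2.
Proof. by rewrite -[RHS]conjg1 -invg1. Qed.

Let pair_inHK h x : (h, x) = inH h * inK x.
Proof. by congr pair; rewrite ?mulg1 ?mul1g. Qed.

(** Only the product of the two [K]-parts survives: all the cross terms are
    killed by coprimality, and the product of the two [H]-parts by hypothesis. *)
Lemma mulLie_coprime_prod :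
    (forall a b : H, starG (a, 1) (b, 1) = (1, 1)) ->
  forall h k x y, starG (h, x) (k, y) = (1, (starG (1, x) (1, y)).2).
Proof.
move=> trivH h k x y.
have coKH : coprime #|[set: K]| #|[set: H]| by rewrite coprime_sym.
have fstr := mulLie_cross_r lieG coKH inKM fstM fst_conjK.
have fstl := mulLie_cross_l lieG coKH inKM fstM fst_conjK.
have sndr := mulLie_cross_r lieG coHK inHM sndM snd_conjH.
have sndl := mulLie_cross_l lieG coHK inHM sndM snd_conjH.
rewrite [LHS]surjective_pairing (pair_inHK h) (mulLie_mull lieG); congr pair.
  rewrite fstM pair_inHK (mulLie_mulr lieG (inH h)) trivH mul1g.
  have conj_fst1 (u v : H * K) : u.1 = 1 -> (u ^ v).1 = 1.
    by move=> u1; rewrite -[LHS]/(u.1 ^ v.1) u1 conj1g.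
  by rewrite !conj_fst1 ?fstl ?fstr ?mulg1.
rewrite sndM sndl mulg1 snd_conjH pair_inHK (mulLie_mulr lieG (inK x)).
by rewrite sndM sndr mul1g snd_conjH.
Qed.

End CoprimeProduct.

Theorem proposition2p7 (m n : nat) (H K : finGroupType)
    (abelH : abelian [set: H]) (cardH : #|[set: H]| = m)
    (cardK : #|[set: K]| = n) (gcd_mn : gcdn m n = 1%N)
    (starG : H * K -> H * K -> H * K) (lieG : isMulLie starG)
    (trivH : forall a b : H, starG (a, 1) (b, 1) = (1, 1)) :
  exists (star : K -> K -> K) (Gamma : K -> {multiplicative H -> H}),
    [/\ isMulLie star,
        forall (x y : K) (h : H),
          Gamma (x * y) h = Gamma x h * Gamma y h /\
          Gamma (star x y) h = Gamma x (Gamma y h) * Gamma y (Gamma x h^-1),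
        forall (x y z : K) (h k l : H),
          Gamma (star x y) l * Gamma (star y z) h * Gamma (star z x) k = 1 &
        forall (h k : H) (x y : K),
          starG (h, x) (k, y) = (Gamma x k * Gamma y h^-1, star x y)].
Proof.
have coHK : coprime #|[set: H]| #|[set: K]| by rewrite cardH cardK; apply/eqP.
pose star (x y : K) := (starG (1, x) (1, y)).2.
have starE h k x y : starG (h, x) (k, y) = (1, star x y).
  exact: (mulLie_coprime_prod _ _ _ coHK lieG trivH).
have sndE (u v : H * K) : (starG u v).2 = star u.2 v.2.
  by rewrite (surjective_pairing u) (surjective_pairing v) starE.
exists star, (fun=> @one_fun H H); split=> [|x y h|x y z h k l|h k x y]; last first.
- by rewrite starE mulg1.
- by rewrite !mulg1.
- by rewrite !mulg1.
(* Each axiom on [K] is the second component of the axiom on [G], taken at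
   elements [(1, x)]. *)
split=> [x|x y z|x y z|x y z|x y z]; pose e (t : K) : H * K := (1, t).
- by rewrite /star (mulLie_alt lieG).
- by have := congr1 snd (mulLie_mulr lieG (e x) (e y) (e z)); rewrite /= !sndE.
- by have := congr1 snd (mulLie_mull lieG (e x) (e y) (e z)); rewrite /= !sndE.
- have := congr1 snd (mulLie_jacobi lieG (e x) (e y) (e z)).
  by rewrite /= !sndE.
- by have := congr1 snd (mulLie_conj lieG (e x) (e y) (e z)); rewrite /= !sndE.
Qed.
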